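(* Let $X,Y$ be Banach spaces. If $X$ has the weak-DD2P, then $X\oplus_\infty Y$ also has the weak-DD2P.
   Context: $X\oplus_\infty Y$ is the product $X\times Y$ with the norm $\|(x,y)\|_\infty=\max\{\|x\|,\|y\|\}$. A Banach space $Z$ (real or complex) with closed unit ball $B_Z$ has the weak-DD2P if for every non-empty relatively weakly open subset $W$ of $B_Z$ there exists $z\in W$ such that $\sup_{y\in V}\|z-y\|=2$ for every relatively weakly open subset $V$ of $B_Z$ with $z\in V$. *)

(* Defs.v *)
From HB Require Import structures.
From mathcomp Require Import all_boot all_order all_algebra.
From mathcomp Require Import all_classical all_reals all_analysis.
From mathcomp Require Export complex.

Set Implicit Arguments.
Unset Strict Implicit.
Unset Printing Implicit Defensive.

Import Order.TTheory GRing.Theory Num.Theory.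
Import numFieldNormedType.Exports.

Local Open Scope classical_set_scope.
Local Open Scope ring_scope.

(* MathComp-Analysis already equips X * Y with the max norm (prod_normE), i.e.
   it is X \oplus_\infty Y, but not with its completeness. *)
Section ProdComplete.
Variables X Y : completeType.

HB.instance Definition _ := Uniform.on (X * Y)%type.
HB.instance Definition _ := Pointed.on (X * Y)%type.

Lemma prod_complete (F : set_system (X * Y)) :
  ProperFilter F -> cauchy F -> cvg F.
Proof.
move=> FF Fc.
have c1 : cauchy (fst @ F).
  move=> A entA; rewrite near_simpl -near2E near_map2; apply: Fc.
  exists (A, setT); first by split=> //=; exact: entourageT.
  by move=> [[a b] [c d]] /= [? _]; exists ((a, c), (b, d)).
have c2 : cauchy (snd @ F).
  move=> A entA; rewrite near_simpl -near2E near_map2; apply: Fc.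
  exists (setT, A); first by split=> //=; exact: entourageT.
  by move=> [[a b] [c d]] /= [_ ?]; exists ((a, c), (b, d)).
move/cauchy_cvg : c1 => c1; move/cauchy_cvg : c2 => c2.
apply/cvg_ex; exists (lim (fst @ F), lim (snd @ F)).
move=> A /(cvg_pair c1 c2) /= FA.
by apply: (@filterS _ F _ _ _ _ FA) => -[].
Qed.

HB.instance Definition _ := Uniform_isComplete.Build (X * Y)%type prod_complete.

End ProdComplete.

HB.instance Definition _ (K : numFieldType) (X Y : completeNormedModType K) :=
  NormedModule.on (X * Y)%type.
HB.instance Definition _ (K : numFieldType) (X Y : completeNormedModType K) :=
  Complete.on (X * Y)%type.

Section WeakDD2P.
Context {K : numFieldType}.

Definition dual (Z : normedModType K) : Type :=
  {f : {linear Z -> K^o} | continuous f}.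

(* The carrier Z with the weak topology, the coarsest one making every
   element of the topological dual of Z continuous. *)
Definition weak_top (Z : normedModType K) : topologicalType :=
  @sup_topology Z (dual Z) (fun f =>
    Topological.class (initial_topology (sval f : Z -> K^o))).

Definition weakly_open (Z : normedModType K) (U : set Z) : Prop :=
  open (U : set (weak_top Z)).

Definition unit_ball (Z : normedModType K) : set Z := [set z | `|z| <= 1].
Arguments unit_ball : clear implicits.

Definition rel_weakly_open (Z : normedModType K) (W : set Z) : Prop :=
  exists2 U : set Z, weakly_open U & W = unit_ball Z `&` U.

(* Norms take their values in the scalar field K.  When K = R[i] the order is
   the partial one (x <= y iff y - x is a nonnegative real), for which the upper
   bounds of a nonempty set of reals are all real; hence [isLub] below is the
   usual supremum of a set of real numbers. *)
Definition weakDD2P (Z : completeNormedModType K) : Prop :=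
  forall W : set Z, rel_weakly_open W -> W !=set0 ->
  exists2 z, W z &
    forall V : set Z, rel_weakly_open V -> V z ->
      isLub [set `|z - y| | y in V] 2.

End WeakDD2P.
Arguments unit_ball {K} Z.

(* Main.v *)
Require Import Defs.
From HB Require Import structures.
From mathcomp Require Import all_boot all_order all_algebra.
From mathcomp Require Import all_classical all_reals all_analysis.

(** The idea is to work inside a horizontal slice.  Let [W] be a nonempty
    relatively weakly open subset of the unit ball of [X * Y] and fix a point
    [(x0, y)] of [W].  The embedding [x |-> (x, y)] of [X] in [X * Y] is affine
    and norm continuous, hence weak-to-weak continuous
    ([affine_weakly_continuous]); for the max norm, and because [`|y| <= 1], the
    preimage of the unit ball of [X * Y] is exactly the unit ball of [X].  So
    slicing at height [y] sends relatively weakly open sets to relatively weakly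
    open sets ([slice_rel_weakly_open]).

    The slice of [W] contains [x0], so the property of [X] provides a point [x]
    of that slice, and [(x, y)] is the point wanted in [W].  Indeed, if [V] is
    relatively weakly open and contains [(x, y)], then the slice of [V] contains
    [x], and the embedding is isometric ([normB_slice]): the distances from
    [(x, y)] to points of [V] include all distances from [x] to points of the
    slice of [V], whose supremum is 2.  No distance exceeds 2 inside a unit
    ball.  The argument is the same over real and over complex scalars. *)

Set Implicit Arguments.
Unset Strict Implicit.
Unset Printing Implicit Defensive.

Import Order.TTheory GRing.Theory Num.Theory.
Import numFieldNormedType.Exports.

Local Open Scope classical_set_scope.
Local Open Scope ring_scope.

Section WeakContinuity.
Variable K : numFieldType.

Lemma dual_weakly_continuous (Z : normedModType K) (f : dual Z) :
  continuous (sval f : weak_top Z -> K^o).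
Proof.
move=> z; apply: cvg_trans (@initial_continuous Z K^o (sval f) z).
apply: cvg_app.
have /cvg_sup/(_ f) : nbhs (z : weak_top Z) --> (z : weak_top Z) by [].
exact.
Qed.

(** The universal property of the weak topology, as an initial topology for the
    family of all continuous functionals. *)
Lemma continuous_to_weak_top (T : topologicalType) (Z : normedModType K)
    (g : T -> weak_top Z) :
  (forall f : dual Z, continuous (sval f \o g)) -> continuous g.
Proof.
move=> fg x; apply/cvg_sup => f.
exact: (@continuous_comp_initial _ _ _ (sval f) g (fg f)).
Qed.

Lemma translation_continuous (Z : normedModType K) (c : Z) :
  continuous (+%R^~ c).
Proof. by move=> z; apply: cvgD; [exact: cvg_id | exact: cvg_cst]. Qed.

(** Composing a functional [f] with an affine map [z |-> L z + b] gives the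
    functional [f \o L] up to the additive constant [f b], and norm continuity
    of [L] makes [f \o L] an element of the dual. *)
Lemma affine_weakly_continuous (Z1 Z2 : normedModType K)
    (L : {linear Z1 -> Z2}) (b : Z2) :
  continuous L -> continuous ((fun z => L z + b) : weak_top Z1 -> weak_top Z2).
Proof.
move=> cL; apply: continuous_to_weak_top => f.
have cfL : continuous ((sval f \o L) : {linear Z1 -> K^o}).
  by move=> z; apply: continuous_comp; [exact: cL | exact: (svalP f)].
rewrite (_ : _ \o _ = fun z => sval f (L z) + sval f b); last first.
  by apply/funext => z /=; rewrite linearD.
move=> z; apply: (@continuous_comp (weak_top Z1) K^o K^o _ (+%R^~ (sval f b))).
  exact: (@dual_weakly_continuous Z1 (exist _ _ cfL)).
exact: (@translation_continuous K^o).
Qed.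

End WeakContinuity.

Section Slice.
Variables (K : numFieldType) (X Y : completeNormedModType K).

Definition inl_prod (x : X) : X * Y := (x, 0).

Lemma inl_prod_is_linear : linear inl_prod.
Proof. by move=> a u v; congr pair; rewrite /= scaler0 addr0. Qed.

HB.instance Definition _ :=
  GRing.isLinear.Build K X (X * Y)%type _ inl_prod inl_prod_is_linear.

Lemma inl_prod_continuous : continuous inl_prod.
Proof. by move=> x; apply: cvg_pair; [exact: cvg_id | exact: cvg_cst]. Qed.

Lemma slice_weakly_open (y : Y) (U : set (X * Y)%type) :
  weakly_open U -> weakly_open [set x : X | U (x, y)].
Proof.
move=> oU; rewrite /weakly_open.
have /continuousP/(_ U oU) :=
  affine_weakly_continuous (b := (0, y)) inl_prod_continuous.
congr (open _); apply/funext => x; rewrite /preimage /=.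
by congr (U (_, _)); rewrite /= ?addr0 ?add0r.
Qed.

Lemma unit_ball_prod (x : X) (y : Y) :
  unit_ball (X * Y)%type (x, y) <-> unit_ball X x /\ unit_ball Y y.
Proof.
by rewrite /unit_ball /= prod_normE /= num_ge_max; split=> [/andP|[-> ->]].
Qed.

Lemma slice_rel_weakly_open (y : Y) (W : set (X * Y)%type) :
  unit_ball Y y -> rel_weakly_open W -> rel_weakly_open [set x : X | W (x, y)].
Proof.
move=> y1 [U oU ->]; exists [set x | U (x, y)]; first exact: slice_weakly_open.
by apply/seteqP; split=> x /= [Bx Ux]; split=> //; move: Bx;
  rewrite unit_ball_prod; [case|].
Qed.

Lemma normB_slice (x x' : X) (y : Y) : `|(x, y) - (x', y)| = `|x - x'|.
Proof. by rewrite prod_normE /= subrr normr0 max_l. Qed.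

End Slice.

Lemma dist_unit_ball_le2 (K : numFieldType) (Z : normedModType K) (u v : Z) :
  unit_ball Z u -> unit_ball Z v -> `|u - v| <= 2.
Proof. by move=> u1 v1; apply: le_trans (ler_normB _ _) (lerD u1 v1). Qed.

Lemma weakDD2P_prodl (K : numFieldType) (X Y : completeNormedModType K) :
  weakDD2P X -> weakDD2P (X * Y)%type.
Proof.
move=> XD W oW [[x0 y] Wxy].
have ball_of (V : set (X * Y)%type) v :
  rel_weakly_open V -> V v -> unit_ball (X * Y)%type v by case=> U _ -> [].
have /unit_ball_prod[_ y1] := ball_of _ _ oW Wxy.
have [|x Wx xD] := XD _ (slice_rel_weakly_open y1 oW); first by exists x0.
exists (x, y) => // V oV Vxy; split.
  move=> _ [v Vv <-].
  by apply: dist_unit_ball_le2; [exact: ball_of Vxy | exact: ball_of Vv].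
move=> b Vb; have [_] := xD _ (slice_rel_weakly_open y1 oV) Vxy; apply.
by move=> _ [x' Vx' <-]; apply: Vb; exists (x', y) => //; exact: normB_slice.
Qed.

Theorem proposition3p3 (R : realType) :
  (forall X Y : completeNormedModType R,
     weakDD2P X -> weakDD2P (X * Y)%type) /\
  (forall X Y : completeNormedModType R[i],
     weakDD2P X -> weakDD2P (X * Y)%type).
Proof. by split=> X Y; exact: weakDD2P_prodl. Qed.
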